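(* Let $\mathbb{S}$ be a collection of subsets of $[d]$, and suppose that $\emptyset \neq J \subseteq [d]$ and $S_0 \in \mathbb{S}$ are such that $J \subseteq S_0$ but $J \cap S = \emptyset$ for all $S \in \mathbb{S} \setminus \{S_0\}$. Let $P_{\mathbb{S}} = (P_S : S \in \mathbb{S}) \in \mathcal{P}_{\mathbb{S}}$ and write $P_{\mathbb{S}}^{-J} := (P_S:S \in \mathbb{S}\setminus \{S_0\},\, P_{S_0}^{S_0 \cap J^c})$. If $P_{\mathbb{S}}^{-J}$ is consistent, then $P_{\mathbb{S}}$ is consistent. Moreover, regardless of consistency, \[ R(P_{\mathbb{S}}) = R(P_{\mathbb{S}}^{-J}). \]
   Context: Let $d \in \mathbb{N}$, $[d] := \{1,\ldots,d\}$, let $\mathcal{X}_1,\ldots,\mathcal{X}_d$ be (non-empty) topological spaces, $\mathcal{X}_S := \prod_{j \in S}\mathcal{X}_j$ with the product topology (a one-point space if $S = \emptyset$), $\mathcal{X} := \mathcal{X}_{[d]}$, $x_S := (x_j : j \in S)$, and $J^c := [d]\setminus J$. $\mathcal{P}_{\mathbb{S}}$ is the set of sequences $(P_S : S \in \mathbb{S})$ with $P_S$ a Borel probability distribution on $\mathcal{X}_S$. For $T \subseteq S$, $P_S^T$ denotes the marginal of $P_S$ on $\mathcal{X}_T$. $P_{\mathbb{S}}$ is consistent if, whenever $S_1,S_2 \in \mathbb{S}$ have $S_1 \cap S_2 \neq \emptyset$, $P_{S_1}^{S_1 \cap S_2} = P_{S_2}^{S_1 \cap S_2}$. Incompatibility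 index: let $\mathcal{G}_S$ be the set of bounded upper semi-continuous functions $\mathcal{X}_S \to [-1,\infty)$ and $\mathcal{G}_{\mathbb{S}}^+ := \{ f_{\mathbb{S}} = (f_S : S \in \mathbb{S}) \in \prod_{S \in \mathbb{S}} \mathcal{G}_S : \inf_{x \in \mathcal{X}} \sum_{S \in \mathbb{S}} f_S(x_S) \geq 0 \}$. Then $R(P_{\mathbb{S}}) := \sup_{f_{\mathbb{S}} \in \mathcal{G}_{\mathbb{S}}^+} \bigl\{-\frac{1}{|\mathbb{S}|}\sum_{S \in \mathbb{S}} \int_{\mathcal{X}_S} f_S \, dP_S\bigr\}$. The sequence $P_{\mathbb{S}}^{-J}$ corresponds to $\mathbb{S}^{-J} := (S \cap J^c : S \in \mathbb{S})$, regarded as a family of subsets of $J^c$ indexed by $\mathbb{S}$ (so it has $|\mathbb{S}|$ members, even if $S_0 \cap J^c$ coincides with another member of $\mathbb{S}$). For $S \in \mathbb{S}$, write $Q_S$ for the member of $P_{\mathbb{S}}^{-J}$ indexed by $S$, i.e. $Q_S := P_S$ for $S \in \mathbb{S} \setminus \{S_0\}$ (for which $S \cap J^c = S$) and $Q_{S_0} := P_{S_0}^{S_0 \cap J^c}$, so that $Q_S$ is a Borel probability distribution on $\mathcal{X}_{S \cap J^c}$. Then $P_{\mathbb{S}}^{-J}$ is consistent if, whenever $S_1,S_2 \in \mathbb{S}$ have $S_1 \cap S_2 \cap J^c \neq \emptyset$, the marginals of $Q_{S_1}$ and $Q_{S_2}$ on $\mathcal{X}_{S_1 \cap S_2 \cap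 J^c}$ are equal. Moreover, \[ R(P_{\mathbb{S}}^{-J}) := \sup \biggl\{-\frac{1}{|\mathbb{S}|}\sum_{S \in \mathbb{S}} \int_{\mathcal{X}_{S \cap J^c}} g_S \, dQ_S\biggr\}, \] where the supremum is over all families $(g_S : S \in \mathbb{S})$ of bounded upper semi-continuous functions $g_S : \mathcal{X}_{S \cap J^c} \to [-1,\infty)$ satisfying $\inf_{x \in \mathcal{X}_{J^c}} \sum_{S \in \mathbb{S}} g_S(x_{S \cap J^c}) \geq 0$. *)

(* Defs.v *)
From HB Require Import structures.
From mathcomp Require Import all_boot all_order all_algebra.
From mathcomp Require Import all_classical all_reals all_analysis.

Set Implicit Arguments.
Unset Strict Implicit.
Unset Printing Implicit Defensive.

Import Order.TTheory GRing.Theory Num.Theory.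
Import numFieldNormedType.Exports.

Local Open Scope classical_set_scope.
Local Open Scope ring_scope.

(* Non-emptiness of the factors is packaged as the point of a ptopologicalType;
   no definition below depends on which point it is. *)
Section product_spaces.
Context (d : nat) (X : 'I_d -> ptopologicalType).

Definition prodX (S : {set 'I_d}) : Type :=
  prod_topology (fun j : {j : 'I_d | j \in S} => X (val j)).

HB.instance Definition _ S := Topological.copy (prodX S)
  (prod_topology (fun j : {j : 'I_d | j \in S} => X (val j))).

HB.instance Definition _ S := isPointed.Build (prodX S) (fun=> point).

(* The sigma-algebra is the Borel one of the product topology, which in general
   is finer than the product of the Borel sigma-algebras of the factors. *)
HB.instance Definition _ S := Measurable.copy (prodX S)
  (g_sigma_algebraType (@open (prodX S))).

Definition restr (T S : {set 'I_d}) (TS : T \subset S) (x : prodX S) :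
  prodX T := fun j => x (exist _ (val j) (fintype.subsetP TS _ (valP j))).

Lemma restr_continuous (T S : {set 'I_d}) (TS : T \subset S) :
  continuous (restr TS).
Proof.
move=> x; apply/cvg_sup => j; apply/cvg_image.
  by rewrite eqEsubset; split=> y // _;
    exists (dfwith (restr TS x) j y) => //; rewrite dfwithin.
move=> A xA.
exists (proj j @^-1` A); last first.
  rewrite eqEsubset; split=> [y [z zA <-]//|y Ay].
  by exists (dfwith (restr TS x) j y); rewrite /proj/= ?dfwithin.
exact: (@proj_continuous _ (fun j : {j : 'I_d | j \in S} => X (val j))
  (exist _ (val j) (fintype.subsetP TS _ (valP j))) x).
Qed.

Lemma restr_measurable (T S : {set 'I_d}) (TS : T \subset S) :
  measurable_fun setT (restr TS).
Proof.
apply: (@measurability _ _ _ _ _ _ (@open (prodX T))) => //.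
move=> _ [B oB <-]; rewrite setTI; apply: sub_sigma_algebra.
by move/continuousP: (restr_continuous (TS := TS)); exact.
Qed.

HB.instance Definition _ (T S : {set 'I_d}) (TS : T \subset S) :=
  isMeasurableFun.Build _ _ _ _ (restr TS) (restr_measurable TS).

Definition marginal (R : realType) (T S : {set 'I_d}) (TS : T \subset S)
    (P : probability (prodX S) R) : probability (prodX T) R :=
  distribution P (restr TS).

End product_spaces.

Definition upper_semicontinuous (T : topologicalType) (R : realType)
    (f : T -> R) := forall x a, f x < a -> \forall y \near x, f y < a.

(* Families are indexed by an arbitrary finite type I rather than by their set
   of members, so that distinct indices may carry the same subset of U. *)
Section families.
Context (R : realType) (d : nat) (X : 'I_d -> ptopologicalType) (I : finType)
  (U : {set 'I_d}) (F : I -> {set 'I_d}) (FU : forall i, F i \subset U).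

Definition consistent (P : forall i, probability (prodX X (F i)) R) :=
  forall i j, F i :&: F j != finset.set0 ->
  forall A : set (prodX X (F i :&: F j)), measurable A ->
    marginal (finset.subsetIl (F i) (F j)) (P i) A =
    marginal (finset.subsetIr (F i) (F j)) (P j) A.

Definition test_function (S : {set 'I_d}) : set (prodX X S -> R) :=
  [set f | [/\ bounded_fun f, upper_semicontinuous f & forall x, -1 <= f x]].

Definition test_family : set (forall i, prodX X (F i) -> R) :=
  [set f | (forall i, test_function (f i)) /\
    (0 <= ereal_inf [set (\sum_i f i (restr (FU i) x))%:E
                    | x in [set: prodX X U]])%E].

Definition incompatibility_index
    (P : forall i, probability (prodX X (F i)) R) : \bar R :=
  ereal_sup [set (- (#|I|%:R^-1 * \sum_i \int[P i]_x f i x))%:E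
            | f in test_family].

End families.
Arguments incompatibility_index {R d X I U F} FU P.

Section coordinate_removal.
Context (R : realType) (d : nat) (X : 'I_d -> ptopologicalType)
  (SS : {set {set 'I_d}}) (S0 J : {set 'I_d}).
Context (JSS : forall S, S \in SS :\ S0 -> J :&: S = finset.set0).

Lemma setI_removed (S : {S | S \in SS}) :
  val S <> S0 -> val S = val S :&: ~: J.
Proof.
move=> SS0; have SJ : J :&: val S = finset.set0.
  by apply: JSS; rewrite !inE (valP S) andbT; exact/eqP.
by rewrite -finset.setDE; apply/esym/finset.setDidPl; rewrite -finset.setI_eq0 finset.setIC SJ.
Qed.

(* For S other than S0, the measure P S itself is kept; the cast only
   identifies S with S :&: ~: J. *)
Definition remove (P : forall S : {S | S \in SS}, probability (prodX X (val S)) R)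
    (S : {S | S \in SS}) : probability (prodX X (val S :&: ~: J)) R :=
  match val S =P S0 with
  | ReflectT _ => marginal (finset.subsetIl (val S) (~: J)) (P S)
  | ReflectF SS0 =>
      ecast T (probability (prodX X T) R) (setI_removed SS0) (P S)
  end.

End coordinate_removal.

(* Main.v *)
Require Import Defs.
From mathcomp Require Import all_boot all_order all_algebra.
From mathcomp Require Import all_classical all_reals all_analysis.
From mathcomp Require Import measurable_realfun.

Set Implicit Arguments.
Unset Strict Implicit.
Unset Printing Implicit Defensive.

Import Order.TTheory GRing.Theory Num.Theory.
Import numFieldNormedType.Exports.

Local Open Scope classical_set_scope.
Local Open Scope ring_scope.

(**
Write A for the complement of J. The coordinates in J occur in S0 only, so they
are constrained by no other measure, and removing them loses nothing.

Consistency: two distinct members of the collection cannot both be S0, hence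
their intersection is contained in A, and the compatibility condition for that
pair says the same before and after the removal. This is
[consistent_remove].

Index: both inequalities transport test families, and for this it is convenient
to treat all members alike, every reduced measure being the marginal of P S on
the coordinates in S :&: A ([removeE]).
- A reduced test family g pulls back along the restriction maps. Restrictions
  are continuous, so upper semicontinuity is kept; the sums are the same
  numbers; the integrals agree by the change of variables formula. Hence
  R(P) is at least the reduced index ([test_family_restr]).
- Conversely, a test family f is pushed down by minimising over the removed
  coordinates: g S (y) is the infimum of f S over all points lying above y
  ([fiber_inf]). An infimum of upper semicontinuous functions is again upper
  semicontinuous. The sum of the infima is still nonnegative, because only the
  fibres over S0 are not single points: near-minimisers chosen separately for
  each S are all restrictions of one point of the full product, obtained by
  gluing ([test_family_fiber_inf]). Finally g S lies below f S along the
  restriction, so its integral is smaller and the reduced index is at least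
  R(P).

Both directions are put together in [incompatibility_index_marginal].
*)

(** * Restriction and gluing of points of a product *)

Section coordinates.
Context (d : nat) (X : 'I_d -> ptopologicalType).

Lemma prodX_irrelevance (S : {set 'I_d}) (x : prodX X S) k
    (p q : k \in S) : x (exist _ k p) = x (exist _ k q).
Proof. by rewrite (bool_irrelevance p q). Qed.

Lemma restr_id (S : {set 'I_d}) (SS : S \subset S) (x : prodX X S) :
  restr SS x = x.
Proof.
apply: functional_extensionality_dep => -[j p]; rewrite /restr/=.
exact: prodX_irrelevance.
Qed.

Lemma restr_restr (T S U : {set 'I_d}) (TS : T \subset S) (SU : S \subset U)
    (TU : T \subset U) (x : prodX X U) : restr TS (restr SU x) = restr TU x.
Proof.
apply: functional_extensionality_dep => -[j p]; rewrite /restr/=.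
exact: prodX_irrelevance.
Qed.

Lemma continuous_prodX (T : topologicalType) (S : {set 'I_d})
    (h : T -> prodX X S) :
  (forall j, continuous (fun t => h t j : X (val j))) -> continuous h.
Proof.
move=> ch t; apply/cvg_sup => j; apply/cvg_image.
  rewrite eqEsubset; split=> y // _.
  by exists (dfwith (h t) j y) => //; rewrite dfwithin.
move=> B tB; exists (proj j @^-1` B); first exact: (ch j t B tB).
rewrite eqEsubset; split=> [y [z zB <-]//|y By].
by exists (dfwith (h t) j y); rewrite /proj/= ?dfwithin.
Qed.

(** The total version, defaulting to the base point outside A and B, lets the
target C be chosen freely without carrying a proof that A and B cover it. *)
Definition glue (A B C : {set 'I_d}) (y : prodX X A) (z : prodX X B) :
    prodX X C := fun j =>
  match @idP (val j \in A), @idP (val j \in B) with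
  | ReflectT p, _ => y (exist _ (val j) p)
  | _, ReflectT q => z (exist _ (val j) q)
  | _, _ => point
  end.
Arguments glue {A B} C y z.

Section glue_theory.
Context (A B C : {set 'I_d}) (y : prodX X A) (z : prodX X B).

Lemma glueL k (c : k \in C) (a : k \in A) :
  glue C y z (exist _ k c) = y (exist _ k a).
Proof.
rewrite /glue/=; case: {-}_ / idP => // a'; exact: prodX_irrelevance.
Qed.

Lemma glueR k (c : k \in C) (b : k \in B) : k \notin A ->
  glue C y z (exist _ k c) = z (exist _ k b).
Proof.
rewrite /glue/= => kA; case: {-}_ / idP => [a|_]; first by rewrite a in kA.
case: {-}_ / idP => // b'; exact: prodX_irrelevance.
Qed.

Lemma restr_glue (AC : A \subset C) : restr AC (glue C y z) = y.
Proof.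
by apply: functional_extensionality_dep => -[j a]; rewrite /restr/= (glueL _ a).
Qed.

End glue_theory.

Lemma glue_restr (T S : {set 'I_d}) (TS : T \subset S) (z : prodX X S) :
  glue S (restr TS z) z = z.
Proof.
apply: functional_extensionality_dep => -[j s].
have [t|t] := boolP (j \in T); last by rewrite (glueR _ _ _ s).
by rewrite (glueL _ _ _ t) /restr/=; exact: prodX_irrelevance.
Qed.

Lemma continuous_glue (A B C : {set 'I_d}) (z : prodX X B) :
  continuous (fun y : prodX X A => glue C y z).
Proof.
apply: continuous_prodX => -[j c].
pose h (y : prodX X A) : X j := glue C y z (exist _ j c).
rewrite -/(continuous h).
have [a|a] := boolP (j \in A).
  have -> : h = fun y => y (exist _ j a) by apply: funext => y; exact: glueL.
  exact: (@proj_continuous _ (fun j : {j : 'I_d | j \in A} => X (val j))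
    (exist _ j a)).
suff [w ->] : exists w, h = fun=> w by move=> y; exact: cvg_cst.
have [b|b] := boolP (j \in B).
  by exists (z (exist _ j b)); apply: funext => y; exact: glueR.
exists point; apply: funext => y; rewrite /h /glue/=.
case: {-}_ / idP => [a'|_]; first by rewrite a' in a.
by case: {-}_ / idP => // b'; rewrite b' in b.
Qed.

(** The next two lemmas recover a prescribed point z from a glued one. In both
of them z agrees with y on the common coordinates; the other coordinates of z
come from z itself being glued in, or do not exist. *)
Section restr_glue_compatible.
Context (S A U : {set 'I_d}) (SU : S \subset U) (y : prodX X A).

Lemma restr_glue_self (z : prodX X S) :
  restr (finset.subsetIl S A) z = restr (finset.subsetIr S A) y ->
  restr SU (glue U y z) = z.
Proof.
move=> zy; apply: functional_extensionality_dep => -[j s]; rewrite /restr/=.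
have [a|a] := boolP (j \in A); last by rewrite (glueR _ _ _ s).
have sa : j \in S :&: A by rewrite inE s.
rewrite (glueL _ _ _ a).
have := congr1 (fun h => h (exist _ j sa)) zy; rewrite /restr/=.
by rewrite (prodX_irrelevance z _ s) (prodX_irrelevance y _ a).
Qed.

Lemma restr_glue_sub (B : {set 'I_d}) (z : prodX X S) (z0 : prodX X B) :
  S \subset A ->
  restr (finset.subsetIl S A) z = restr (finset.subsetIr S A) y ->
  restr SU (glue U y z0) = z.
Proof.
move=> SA zy; rewrite -[RHS]restr_glue_self//.
apply: functional_extensionality_dep => -[j s]; rewrite /restr/=.
by rewrite !(glueL _ _ _ (fintype.subsetP SA _ s)).
Qed.

End restr_glue_compatible.

End coordinates.
Arguments glue {d X A B} C y z.

(** * Test functions, their integrals and their infima over fibres *)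

Section test_functions.
Context (R : realType) (d : nat) (X : 'I_d -> ptopologicalType).
Implicit Types S T : {set 'I_d}.

(** The lower bound -1 reduces boundedness to a one-sided condition, which is
the form that is stable under infima. *)
Lemma test_functionP S (f : prodX X S -> R) :
  test_function f <->
  [/\ exists M, forall x, f x <= M, upper_semicontinuous f &
     forall x, -1 <= f x].
Proof.
have pf : ProperFilter (globally [set: prodX X S]).
  exact: (@globally_properfilter _ _ (point : prodX X S)).
split=> -[fb usc f1]; split => //.
  have /ex_bound[M fM] : [bounded f x | x in setT] := fb.
  by exists M => x; exact: le_trans (ler_norm _) (fM x I).
case: fb => M fM; apply/ex_bound; exists (Num.max M 1) => x _ /=.
rewrite ler_norml; apply/andP; split.
  by rewrite (le_trans _ (f1 x))// lerN2 le_max lexx orbT.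
by rewrite le_max fM.
Qed.

(** The strict sublevel sets are open and the sigma-algebra is generated by all
the open sets of the product. *)
Lemma upper_semicontinuous_measurable S (f : prodX X S -> R) :
  upper_semicontinuous f -> measurable_fun setT f.
Proof.
move=> usc; apply: (measurability _ (RGenInftyO.measurableE R)).
move=> _ [_ [a ->] <-]; rewrite setTI; apply: sub_sigma_algebra.
have oa : open [set x | f x < a] by rewrite openE => x; exact: usc.
rewrite (_ : _ @^-1` _ = [set x | f x < a]); first exact: oa.
by apply/seteqP; split=> x /=; rewrite in_itv.
Qed.

Lemma test_function_integrable S (mu : probability (prodX X S) R)
    (f : prodX X S -> R) :
  test_function f -> mu.-integrable setT (EFin \o f).
Proof.
move=> [fb usc _]; apply: measurable_bounded_integrable => //.
  by rewrite [X in (X < _)%E](@probability_setT _ _ _ mu) ltry.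
exact: upper_semicontinuous_measurable.
Qed.

Lemma test_function_restr T S (TS : T \subset S) (g : prodX X T -> R) :
  test_function g -> test_function (g \o restr TS).
Proof.
move=> /test_functionP[[M gM] usc g1]; apply/test_functionP; split => //.
- by exists M => x; exact: gM.
- by move=> x a gxa; exact: (restr_continuous (usc _ _ gxa)).
- by move=> x; exact: g1.
Qed.

(** Q only has to agree with the marginal as a set function: this is how the
lemma applies to a measure that is transported along an equality of index
sets. *)
Lemma Rintegral_marginal T S (TS : T \subset S) (P : probability (prodX X S) R)
    (Q : probability (prodX X T) R) (g : prodX X T -> R) :
  (forall B, measurable B -> Q B = marginal TS P B) -> test_function g ->
  \int[Q]_x g x = \int[P]_x g (restr TS x).
Proof.
move=> QP tg; have [_ usc _] := tg; congr fine.
rewrite (eq_measure_integral (marginal TS P)); last by move=> B mB _; exact: QP.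
rewrite integral_distribution//.
  by apply/measurable_EFinP; exact: upper_semicontinuous_measurable.
exact: (test_function_integrable P (test_function_restr TS tg)).
Qed.

Definition fiber_inf T S (TS : T \subset S) (f : prodX X S -> R)
    (y : prodX X T) : R := inf [set f z | z in restr TS @^-1` [set y]].

Section fiber_inf.
Context T S (TS : T \subset S) (f : prodX X S -> R) (tf : test_function f).

Lemma fiber_has_inf y : has_inf [set f z | z in restr TS @^-1` [set y]].
Proof.
have [_ _ f1] := tf; split; last by exists (-1) => _ [z _ <-]; exact: f1.
pose z := glue S y (point : prodX X S).
by exists (f z), z => //=; exact: restr_glue.
Qed.

Lemma fiber_inf_le z : fiber_inf TS f (restr TS z) <= f z.
Proof. by apply: ge_inf; [exact: (fiber_has_inf _).2|exists z]. Qed.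

(** For upper semicontinuity, suppose that the infimum over the fibre of y is
below a. Then f z < a for some z above y, and replacing the coordinates of z in
T by those of a nearby y' moves z continuously to a point above y', where f is
still below a. *)
Lemma test_function_fiber_inf : test_function (fiber_inf TS f).
Proof.
have /test_functionP[[M fM] usc f1] := tf.
apply/test_functionP; split.
- exists M => y; have [[_ [z <- _]] _] := fiber_has_inf y.
  exact: le_trans (fiber_inf_le z) (fM z).
- move=> y a /inf_lt => /(_ (fiber_has_inf y).1)[_ [z /= zy <-] fza].
  have {}fza : f (glue S y z) < a by rewrite -zy glue_restr.
  have : \forall y' \near y, f (glue S y' z) < a.
    exact: (@continuous_glue _ _ _ _ _ z y _ (usc _ _ fza)).
  apply: filterS => y'; apply: le_lt_trans.
  by have := fiber_inf_le (glue S y' z); rewrite restr_glue.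
- move=> y; apply: lb_le_inf; first exact: (fiber_has_inf y).1.
  by move=> _ [z _ <-]; exact: f1.
Qed.

End fiber_inf.

End test_functions.

(** * Comparison of the two indices *)

Section index.
Context (R : realType) (d : nat) (X : 'I_d -> ptopologicalType) (I : finType)
  (F : I -> {set 'I_d}) (A : {set 'I_d}).

Let FU i : F i \subset [set: 'I_d]%SET := finset.subsetT (F i).
Let FA i : F i :&: A \subset A := finset.subsetIr (F i) A.
Let FAF i : F i :&: A \subset F i := finset.subsetIl (F i) A.

Lemma test_familyP (U : {set 'I_d}) (G : I -> {set 'I_d})
    (GU : forall i, G i \subset U) (f : forall i, prodX X (G i) -> R) :
  test_family GU f <-> (forall i, test_function (f i)) /\
    forall x, 0 <= \sum_i f i (restr (GU i) x).
Proof.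
split=> -[tf f0]; split=> //.
  move=> x; rewrite -lee_fin; move/ereal_infP : f0; apply.
  by exists x.
by apply/ereal_infP => _ [x _ <-]; rewrite lee_fin.
Qed.

Lemma test_family_restr (g : forall i, prodX X (F i :&: A) -> R) :
  test_family FA g -> test_family FU (fun i => g i \o restr (FAF i)).
Proof.
move=> /test_familyP[tg g0]; apply/test_familyP; split=> [i|x].
  exact: test_function_restr.
have := g0 (restr (finset.subsetT A) x); congr (_ <= _).
apply: eq_bigr => i _ /=.
by rewrite !(restr_restr _ _ (finset.subsetT (F i :&: A))).
Qed.

(** All the near-minimisers come from the single point that takes its
coordinates in A from y and the remaining ones from the near-minimiser for i0:
the other members have no coordinate outside A. *)
Lemma test_family_fiber_inf (i0 : I) (FiA : forall i, i != i0 -> F i \subset A)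
    (f : forall i, prodX X (F i) -> R) :
  test_family FU f -> test_family FA (fun i => fiber_inf (FAF i) (f i)).
Proof.
move=> /test_familyP[tf f0]; apply/test_familyP; split=> [i|y].
  exact: test_function_fiber_inf.
apply/ler_addgt0Pr => e e0.
have I0 : (0 < #|I|)%N by apply/card_gt0P; exists i0.
(* Each of the #|I| infima is approximated up to e', for a total error e. *)
pose e' : R := e / #|I|%:R.
have e'0 : 0 < e' by rewrite divr_gt0// ltr0n.
have near_inf i : exists2 z, restr (FAF i) z = restr (FA i) y &
    f i z <= fiber_inf (FAF i) (f i) (restr (FA i) y) + e'.
  have [_ [z zy <-] fz] := inf_adherent e'0
    (fiber_has_inf (FAF i) (tf i) (restr (FA i) y)).
  by exists z => //; exact: ltW.
pose z i := s2val (cid2 (near_inf i)).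
have zy i : restr (FAF i) (z i) = restr (FA i) y := s2valP (cid2 (near_inf i)).
have fz i := s2valP' (cid2 (near_inf i)).
apply: le_trans (f0 (glue finset.setT y (z i0))) _.
have -> : e = \sum_(i : I) e'.
  by rewrite sumr_const -[RHS]mulr_natr divfK// pnatr_eq0 -lt0n.
rewrite -big_split/=; apply: ler_sum => i _.
suff -> : restr (FU i) (glue finset.setT y (z i0)) = z i by exact: fz.
have [->|ii0] := eqVneq i i0; first exact: restr_glue_self.
exact: restr_glue_sub (FiA _ ii0) (zy i).
Qed.

Lemma incompatibility_index_marginal (i0 : I)
    (FiA : forall i, i != i0 -> F i \subset A)
    (P : forall i, probability (prodX X (F i)) R)
    (Q : forall i, probability (prodX X (F i :&: A)) R) :
  (forall i B, measurable B -> Q i B = marginal (FAF i) (P i) B) ->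
  incompatibility_index FU P = incompatibility_index FA Q.
Proof.
move=> QP; apply/eqP; rewrite eq_le; apply/andP; split.
  apply: ge_ereal_sup => _ [f tf <-].
  have tg := test_family_fiber_inf FiA tf.
  have [[tfi _] [tgi _]] := (tf, tg).
  apply: le_trans (ereal_sup_ubound _); last by eexists; [exact: tg|reflexivity].
  rewrite lee_fin lerN2 ler_wpM2l ?invr_ge0//; apply: ler_sum => i _.
  rewrite (Rintegral_marginal (QP i) (tgi i)).
  apply: le_Rintegral => //.
  - exact: (test_function_integrable (P i) (test_function_restr (FAF i) (tgi i))).
  - exact: test_function_integrable.
  - by move=> x _; exact: fiber_inf_le.
apply: ge_ereal_sup => _ [g tg <-]; apply: ereal_sup_ubound.
exists (fun i => g i \o restr (FAF i)); first exact: test_family_restr.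
do 3 congr (_ _); apply: eq_bigr => i _; have [tgi _] := tg.
by rewrite (Rintegral_marginal (QP i) (tgi i)).
Qed.

End index.

(** * The reduced family *)

Section removal.
Context (R : realType) (d : nat) (X : 'I_d -> ptopologicalType)
  (SS : {set {set 'I_d}}) (S0 J : {set 'I_d}).
Context (JSS : forall S, S \in SS :\ S0 -> J :&: S = finset.set0).
Context (P : forall S : {S | S \in SS}, probability (prodX X (val S)) R).

Lemma ecast_marginal (T S : {set 'I_d}) (TS : T \subset S) (e : S = T)
    (mu : probability (prodX X S) R) (B : set (prodX X T)) :
  (ecast U (probability (prodX X U) R) e mu) B = marginal TS mu B.
Proof.
case: T / e TS B => TS B /=.
by rewrite /marginal/distribution/pushforward/=; congr (mu _);
  apply/seteqP; split=> x /=; rewrite restr_id.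
Qed.

(** For S other than S0, restricting to S :&: ~: J forgets nothing, so the marginal
description covers the members that the removal leaves untouched as well. *)
Lemma removeE S B :
  remove JSS P S B = marginal (finset.subsetIl (val S) (~: J)) (P S) B.
Proof. by rewrite /remove; case: eqP => // SS0; exact: ecast_marginal. Qed.

Lemma removed_subset (S : {S | S \in SS}) : val S != S0 -> val S \subset ~: J.
Proof. by move=> /eqP/(setI_removed JSS)->; exact: finset.subsetIr. Qed.

Lemma consistent_remove : consistent (remove JSS P) -> consistent P.
Proof.
move=> cQ S1 S2 S12 B mB.
have [e|S1S2] := eqVneq S1 S2.
  subst S2; rewrite /marginal.
  by rewrite (bool_irrelevance (finset.subsetIl _ _) (finset.subsetIr _ _)).
have sub : val S1 :&: val S2 \subset (val S1 :&: ~: J) :&: (val S2 :&: ~: J).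
  rewrite -finset.setIIl finset.subsetI subxx/=.
  have [e|/removed_subset] := eqVneq (val S1) S0.
    apply: fintype.subset_trans (finset.subsetIr _ _) (removed_subset _).
    by rewrite -e eq_sym; apply: contra_neq S1S2; exact: val_inj.
  by move=> h; apply: fintype.subset_trans (finset.subsetIl _ _) h.
have S12' : (val S1 :&: ~: J) :&: (val S2 :&: ~: J) != finset.set0.
  by apply: contraNneq S12 => e; rewrite -finset.subset0 -e.
(* A set B on the coordinates of S1 :&: S2 is tested through its preimage on
   the equal, but not convertible, coordinate set of the reduced pair. *)
have mB' : measurable (@restr _ X _ _ sub @^-1` B).
  by rewrite -[X in measurable X]setTI; exact: restr_measurable.
have removed_marginal (S T : {set 'I_d}) (i : {S | S \in SS})
    (TS : T \subset val i :&: ~: J)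
    (ST : S \subset T) (SI : S \subset val i) (C : set (prodX X S)) :
    marginal TS (remove JSS P i) (restr ST @^-1` C) = marginal SI (P i) C.
  rewrite [LHS]removeE; congr (P i _); apply: funext => x; congr C.
  rewrite (restr_restr _ _ (fintype.subset_trans ST TS)).
  exact: restr_restr.
have := cQ S1 S2 S12' _ mB'.
by rewrite (removed_marginal _ _ _ _ _ (finset.subsetIl _ _))
  (removed_marginal _ _ _ _ _ (finset.subsetIr _ _)).
Qed.

End removal.

Theorem proposition9 (R : realType) (d : nat) (X : 'I_d -> ptopologicalType)
    (SS : {set {set 'I_d}}) (J S0 : {set 'I_d})
    (J_neq0 : J != finset.set0) (S0_SS : S0 \in SS) (JS0 : J \subset S0)
    (JSS : forall S, S \in SS :\ S0 -> J :&: S = finset.set0)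
    (P : forall S : {S | S \in SS}, probability (prodX X (val S)) R) :
  (consistent (remove JSS P) -> consistent P) /\
  incompatibility_index (fun S => finset.subsetT (val S)) P =
  incompatibility_index (fun S => finset.subsetIr (val S) (~: J)) (remove JSS P).
Proof.
split; first exact: consistent_remove.
apply: (@incompatibility_index_marginal _ _ _ _ val (~: J) (exist _ S0 S0_SS)).
  by move=> S SS0; apply: (removed_subset JSS).
by move=> S B _; exact: removeE.
Qed.
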